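(* Let $G$ be a connected non-bipartite simple graph. Then there exists $K$ such that for every $k\ge K$ with $k\equiv 2\pmod 4$, $\lambda_{\max}^{\mathcal{L}}(G^{k,\frac{k}{2}})<\rho^{\mathcal{L}}(G^{k,\frac{k}{2}})$.
   Context: Tensors: for a real order-$k$, dimension-$n$ tensor $\mathcal{T}$ and $x\in\mathbb{C}^n$, $(\mathcal{T}x^{k-1})_i=\sum_{i_2,\dots,i_k}t_{ii_2\dots i_k}x_{i_2}\cdots x_{i_k}$; $\lambda\in\mathbb{C}$ is an eigenvalue with eigenvector $x\ne0$ if $\mathcal{T}x^{k-1}=\lambda x^{[k-1]}$, $x^{[k-1]}=(x_i^{k-1})_i$; an eigenvalue with a real eigenvector is an $H$-eigenvalue. For a hypergraph $H$, $\lambda_{\max}^{\mathcal{L}}(H)$ is the largest $H$-eigenvalue of $\mathcal{L}(H)$ and $\rho^{\mathcal{L}}(H)$ its spectral radius (maximum modulus of eigenvalues). Hypergraphs: degree $d_v$ = number of edges containing $v$. For a $k$-uniform hypergraph on $v_1,\dots,v_n$, $\mathcal{A}$ has $a_{i_1\dots i_k}=\frac{1}{(k-1)!}$ if $\{v_{i_1},\dots,v_{i_k}\}$ is an edge, else $0$; $\mathcal{D}$ diagonal with $d_{i\dots i}=d_{v_i}$; Laplacian tensor $\mathcal{L}=\mathcal{D}-\mathcal{A}$. Generalized power $G^{k,\frac{k}{2}}$ ($k\ge4$ even): replace each vertex $v$ of $G$ by a set $\mathbf{v}$ of $\frac{k}{2}$ vertices containing $v$ (pairwise disjoint), and for each edge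 $\{u,v\}$ of $G$ take $\mathbf{u}\cup\mathbf{v}$ as an edge. *)

(* Defs.v *)
From HB Require Import structures.
From mathcomp Require Import all_boot all_order all_algebra.
From mathcomp Require Import reals complex.

Set Implicit Arguments.
Unset Strict Implicit.
Unset Printing Implicit Defensive.

Import Order.TTheory GRing.Theory Num.Theory.
Local Open Scope ring_scope.
Local Open Scope complex_scope.

Definition graph_connected (V : finType) (e : rel V) : Prop :=
  forall u v : V, connect e u v.

Definition bipartite (V : finType) (e : rel V) : Prop :=
  exists A : {set V}, forall u v : V, e u v -> (u \in A) != (v \in A).

(* Tensors of order k are indexed by a finite type I, whose cardinal is the
   dimension. *)
Definition tensor (R : Type) (I : finType) (k : nat) := {ffun k.-tuple I -> R}.

Section Eigenvalues.
Variables (R : realType) (I : finType) (k : nat).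
Implicit Types (T : tensor R I k) (x : {ffun I -> R[i]}).

(* (T x^(k-1))_i: the tuple t ranges over (i, i_2, ..., i_k). *)
Definition tensor_apply T x (i : I) : R[i] :=
  \sum_(t : k.-tuple I | ohead t == Some i)
     (T t)%:C * \prod_(j <- behead t) x j.

Definition eigenpair T (lambda : R[i]) x : Prop :=
  x != 0 /\ forall i, tensor_apply T x i = lambda * x i ^+ k.-1.

Definition eigenvalue T (lambda : R[i]) : Prop :=
  exists x, eigenpair T lambda x.

Definition H_eigenvalue T (lambda : R[i]) : Prop :=
  exists y : {ffun I -> R}, eigenpair T lambda [ffun i => (y i)%:C].

(* In R[i], a <= b means that b - a is a nonnegative real; the H-eigenvalues of
   a real tensor are all real. *)
Definition largest_H_eigenvalue T (r : R) : Prop :=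
  H_eigenvalue T r%:C /\
  forall mu : R[i], H_eigenvalue T mu -> mu <= r%:C.

Definition spectral_radius T (r : R) : Prop :=
  (exists2 mu : R[i], eigenvalue T mu & `|mu| = r%:C) /\
  forall mu : R[i], eigenvalue T mu -> `|mu| <= r%:C.

End Eigenvalues.

(* A hypergraph on W is given by its set of edges E. *)
Section Laplacian.
Variables (R : realType) (W : finType) (k : nat) (E : {set {set W}}).

Definition hdegree (v : W) : nat := #|[set A in E | v \in A]|.

Definition adjacency_tensor : tensor R W k :=
  [ffun t : k.-tuple W =>
     if [set v in t] \in E then ((k.-1)`!%:R)^-1 else 0].

Definition degree_tensor : tensor R W k :=
  [ffun t : k.-tuple W =>
     (if tval t is v :: s then
        if all (pred1 v) s then (hdegree v)%:R else 0
      else 0) : R].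

Definition laplacian_tensor : tensor R W k :=
  [ffun t => degree_tensor t - adjacency_tensor t].

End Laplacian.

(* Generalized power G^{k,k/2}: the vertex v of G becomes the block of the
   pairs (v, j) with j < k/2, the pair (v, 0) playing the role of v itself. *)
Definition power_vertex (V : finType) (k : nat) : finType :=
  (V * 'I_(k./2))%type.

Definition block (V : finType) (k : nat) (v : V) : {set power_vertex V k} :=
  [set p | p.1 == v].

Definition power_edges (V : finType) (e : rel V) (k : nat) :
    {set {set power_vertex V k}} :=
  [set block k p.1 :|: block k p.2 | p in [set p : V * V | e p.1 p.2]].

(* Main.v *)
Require Import Defs.
From mathcomp Require Import all_boot all_order all_algebra.
From mathcomp Require Import sesquilinear spectral.
From mathcomp Require Import reals complex.
From mathcomp Require Import boolp topology normedtype trigo.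
From mathcomp Require Import ring zify.

Set Implicit Arguments.
Unset Strict Implicit.
Unset Printing Implicit Defensive.

Import Order.TTheory GRing.Theory Num.Theory.
Import numFieldNormedType.Exports.
Local Open Scope ring_scope.
Local Open Scope complex_scope.
Local Open Scope sesquilinear_scope.

(** Put m = k/2, which is odd, and let X_v be the product of the entries of x
   over the block of v.  Multiplying the eigenvalue equation at (v, j) by
   x_(v,j) gives (d_v - lambda) x_(v,j)^k = X_v * sum_(u ~ v) X_u.  Unless
   lambda is a degree, x_(v,j)^k does not depend on j, so that
   X_v^2 = zeta_v x_(v,j)^k with zeta_v^m = 1 or zeta_v = 0, and lambda is an
   eigenvalue of D - diag(zeta) A.  For fixed k this leaves finitely many
   eigenvalues, so both maxima exist as soon as there are candidates.

   For real x, oddness of m forces zeta_v in {0, 1}.  The resulting finite set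
   of real numbers does not depend on k, and comparing the quadratic form of
   D - diag(zeta) A at X with the one of D + A at |X| bounds it strictly by the
   top eigenvalue q of D + A: equality would make |X| a positive Perron vector
   and the signs of X a bipartition.

   Conversely, for zeta^m = 1 every eigenvalue of D - zeta A is an eigenvalue
   of the tensor.  As m grows such zeta approach -1 (they avoid -1 itself), so
   the value at q of the characteristic polynomial of D - zeta A tends to 0 and
   some eigenvalue of D - zeta A tends to q. *)

(** * Spectra of matrices *)

Lemma form_diag_mx (C : numClosedFieldType) n (d z : 'rV[C]_n) :
  (z *m diag_mx d *m z ^t*) 0 0 = \sum_i d 0 i * `|z 0 i| ^+ 2.
Proof.
rewrite mxE; apply: eq_bigr => i _.
by rewrite mul_mx_diag !mxE mulrAC -normCK mulrC.
Qed.

Lemma form_mx1 (C : numClosedFieldType) n (z : 'rV[C]_n) :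
  (z *m z ^t*) 0 0 = \sum_i `|z 0 i| ^+ 2.
Proof. by rewrite mxE; apply: eq_bigr => i _; rewrite !mxE normCK. Qed.

(** In an orthonormal eigenbasis the form is a sum of squared moduli weighted by the eigenvalues,
    and [q] is the largest weight. Equality forces the coordinates at smaller eigenvalues to
    vanish. *)
Lemma hermsym_max_eigenvalue (C : numClosedFieldType) n (A : 'M[C]_n) :
  (0 < n)%N -> A \is hermsymmx ->
  exists2 q, q \is Num.real &
    mxalgebra.eigenvalue A q /\
    forall w : 'rV_n,
      (w *m A *m w ^t*) 0 0 <= q * (w *m w ^t*) 0 0 /\
      ((w *m A *m w ^t*) 0 0 = q * (w *m w ^t*) 0 0 -> w *m A = q *: w).
Proof.
move=> n_gt0 Ah; set P := spectralmx A; set d := spectral_diag A.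
have dreal i : d 0 i \is Num.real.
  by have /mxOverP := hermitian_spectral_diag_real Ah; apply.
have Pu : P \is unitarymx := spectral_unitarymx A.
have Punit : P \in unitmx := spectral_unit A.
have AE : A = P ^t* *m diag_mx d *m P.
  by rewrite -(invmx_unitary Pu); apply/orthomx_spectralP/hermitian_normalmx.
have PtP : P ^t* *m P = 1%:M by rewrite -(invmx_unitary Pu) mulVmx.
have PPt : P *m P ^t* = 1%:M by apply/unitarymxP.
pose i0 := [arg max_(i > Ordinal n_gt0 | true) d 0 i]%O.
have dmax i : d 0 i <= d 0 i0.
  by rewrite /i0; case: real_arg_maxP => // j _; apply.
exists (d 0 i0) => //; split.
  apply/eigenvalueP; exists (row i0 P).
    rewrite AE !mulmxA -row_mul PPt.
    rewrite -row_mul mul1mx -row_mul; apply/rowP => j.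
    rewrite !mxE (bigD1 i0) //= big1 ?addr0 ?mxE ?eqxx ?mulr1n // => l li.
    by rewrite !mxE eq_sym (negPf li) mulr0n mul0r.
  apply/negP => /eqP r0.
  have /row_freeP [B PB] : row_free P by rewrite row_free_unit.
  have := congr1 (mulmx^~ B) r0; rewrite -row_mul PB mul0mx.
  by move/rowP/(_ i0); rewrite !mxE eqxx; apply/eqP; rewrite oner_eq0.
move=> w; have [z zE] : exists z : 'rV_n, z = w *m P ^t* by eexists.
have zt : z ^t* = P *m w ^t*.
  by rewrite zE trmx_mul map_mxM trmxCK.
have f1 : (w *m A *m w ^t*) 0 0 = \sum_i d 0 i * `|z 0 i| ^+ 2.
  by rewrite -form_diag_mx zt AE zE !mulmxA.
have f2 : (w *m w ^t*) 0 0 = \sum_i `|z 0 i| ^+ 2.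
  by rewrite -form_mx1 zt zE mulmxA -(mulmxA w) PtP mulmx1.
rewrite f1 f2 mulr_sumr.
have term i : d 0 i * `|z 0 i| ^+ 2 <= d 0 i0 * `|z 0 i| ^+ 2.
  by rewrite ler_wpM2r ?exprn_ge0.
split; first exact: ler_sum.
move/eqP; rewrite eq_sym -subr_eq0 -sumrB psumr_eq0 => [|i _]; last first.
  by rewrite subr_ge0.
move/allP => h.
have zd : z *m diag_mx d = d 0 i0 *: z.
  apply/rowP => i; rewrite mul_mx_diag !mxE.
  have := h i; rewrite mem_index_enum => /(_ isT) /=.
  rewrite -mulrBl mulf_eq0 sqrf_eq0 normr_eq0 subr_eq0.
  by case/orP => /eqP -> //; rewrite ?mul0r ?mulr0 // mulrC.
by rewrite AE !mulmxA -zE zd -scalemxAl zE -mulmxA PtP mulmx1.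
Qed.

Lemma horner_char_poly (R : comNzRingType) n (A : 'M[R]_n) a :
  (char_poly A).[a] = \det (a%:M - A).
Proof.
rewrite -horner_evalE /char_poly -det_map_mx; congr (\det _).
by apply/matrixP => i j; rewrite !mxE /= /horner_eval !(hornerE, hornerMn).
Qed.

Lemma horner_norm_bound (C : numDomainType) (p : {poly C}) :
  exists2 b : C, 0 <= b & forall x, `|x| <= 1 -> `|p.[x]| <= b.
Proof.
elim/poly_ind: p => [|p c [b b0 pb]].
  by exists 0 => // x; rewrite horner0 normr0.
exists (b + `|c|); first by rewrite addr_ge0.
move=> x x1; rewrite hornerMXaddC (le_trans (ler_normD _ _)) // lerD2r normrM.
by rewrite -[b]mulr1 ler_pM ?pb.
Qed.

Lemma char_poly_seq_eigenvalues (C : numClosedFieldType) n (A : 'M[C]_n) :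
  {r : seq C | char_poly A = \prod_(z <- r) ('X - z%:P) & size r = n}.
Proof.
have [r rE] := closed_field_poly_normal (char_poly A).
exists r; first by rewrite {1}rE (monicP (char_poly_monic A)) scale1r.
have := size_char_poly A; rewrite rE (monicP (char_poly_monic A)) scale1r.
by rewrite size_prod_XsubC => -[].
Qed.

(* The characteristic polynomial at q is the product of the q - z over the
   eigenvalues z, so it is not small when all of them have modulus at most b. *)
Lemma ex_eigenvalue_norm_gt (C : numClosedFieldType) n (A : 'M[C]_n) q b :
  b \is Num.real -> q \is Num.real -> b < q ->
  `|(char_poly A).[q]| < (q - b) ^+ n ->
  exists2 z, root (char_poly A) z & b < `|z|.
Proof.
move=> br qr bq; have [r rE rn] := char_poly_seq_eigenvalues A.
have [/hasP[z zr zb] _|/hasPn h] := boolP (has (fun z => b < `|z|) r).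
  by exists z => //; rewrite rE root_prod_XsubC.
have {}h z : z \in r -> q - b <= `|q - z|.
  move=> /h; rewrite -real_leNgt // => zb.
  have qz : q - `|z| <= `|q - z|.
    rewrite (le_trans _ (lerB_dist _ _)) // lerD2r.
    by rewrite real_ler_norm.
  by apply: le_trans qz; rewrite lerD2l lerN2.
move=> lt; suff : (q - b) ^+ n <= `|(char_poly A).[q]|.
  by move/(lt_le_trans lt); rewrite ltxx.
rewrite rE horner_prod normr_prod -rn.
elim: r h {rE rn lt} => [|z r IH] h; first by rewrite big_nil expr0.
have qb0 : 0 <= q - b by rewrite subr_ge0 ltW.
rewrite big_cons /= exprS hornerXsubC ler_pM ?exprn_ge0 ?h ?mem_head //.
by apply: IH => y yr; rewrite h // inE yr orbT.
Qed.

Lemma det_pencil_poly (R : comNzRingType) n (A B : 'M[R]_n) :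
  {p : {poly R} | forall x, p.[x] = \det (A + x *: B)}.
Proof.
exists (\det (map_mx polyC A + 'X *: map_mx polyC B)) => x.
rewrite -horner_evalE -det_map_mx; congr (\det _).
by apply/matrixP => i j; rewrite !mxE /= /horner_eval !hornerE.
Qed.

(** The root [x0] splits off a factor [x - x0], and the cofactor is bounded on the unit disc. This
    yields an explicit [d] by algebra alone, without topology. *)
Lemma det_pencil_small (C : numFieldType) n (A B : 'M[C]_n) x0 eps :
  \det (A + x0 *: B) = 0 -> 0 < eps ->
  exists2 d : C, 0 < d & forall x, `|x| <= 1 -> `|x - x0| < d ->
    `|\det (A + x *: B)| < eps.
Proof.
have [p pE] := det_pencil_poly A B; rewrite -pE => /rootP/factor_theorem[g gE].
have [b b0 gb] := horner_norm_bound g => e0.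
have b1 : 0 < b + 1 by rewrite ltr_wpDl.
exists (eps / (b + 1)) => [|x x1]; first by rewrite divr_gt0.
rewrite ltr_pdivlMr // => xd.
rewrite -pE gE hornerM hornerXsubC normrM mulrC (le_lt_trans _ xd) //.
by rewrite ler_wpM2l // (le_trans (gb _ x1)) // lerDl.
Qed.

(** * The matrices D - diag(zeta) A of a graph *)

Section TwistedGraph.
Variables (C : numClosedFieldType) (V : finType) (e : rel V).
Hypothesis e_sym : symmetric e.

Definition deg (v : V) : nat := #|[set u | e v u]|.

(* The matrix D - diag(zeta) A, transposed so as to act on row vectors. *)
Definition twisted_mx (zeta : V -> C) : 'M[C]_#|V| :=
  \matrix_(i, j) ((deg (enum_val j))%:R *+ (i == j)
                  - zeta (enum_val j) *+ e (enum_val j) (enum_val i)).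

Definition twisted_eigen (zeta : V -> C) (lambda : C) (X : V -> C) : Prop :=
  (exists v, X v != 0) /\
  forall v, ((deg v)%:R - lambda) * X v = zeta v * \sum_(u | e v u) X u.

Lemma mul_twisted_mx (zeta : V -> C) (w : 'rV_#|V|) j :
  (w *m twisted_mx zeta) 0 j =
    (deg (enum_val j))%:R * w 0 j
    - zeta (enum_val j) * \sum_(u | e (enum_val j) u) w 0 (enum_rank u).
Proof.
rewrite mxE (eq_bigr (fun i => (w 0 i * (deg (enum_val j))%:R) *+ (i == j) -
   w 0 i * (zeta (enum_val j) *+ e (enum_val j) (enum_val i)))); last first.
  by move=> i _; rewrite !mxE mulrBr (mulrnAr (w 0 i) _ (i == j)).
rewrite sumrB; congr (_ - _).
  rewrite (bigD1 j) //= eqxx mulr1n big1 ?addr0 1?mulrC // => i /negPf ->.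
  by rewrite mulr0n.
rewrite mulr_sumr [RHS]big_mkcond (reindex _ (onW_bij _ (enum_val_bij V))) /=.
apply: eq_bigr => i _; rewrite enum_valK.
by case: (e _ _); rewrite ?mulr1n ?mulr0n ?mulr0 // mulrC.
Qed.

Lemma mul_row_twisted_mx (zeta X : V -> C) j :
  ((\row_i X (enum_val i)) *m twisted_mx zeta) 0 j =
    (deg (enum_val j))%:R * X (enum_val j)
    - zeta (enum_val j) * \sum_(u | e (enum_val j) u) X u.
Proof.
rewrite mul_twisted_mx mxE; congr (_ - _ * _).
by apply: eq_bigr => u _; rewrite mxE enum_rankK.
Qed.

Lemma twisted_eigenP (zeta : V -> C) lambda :
  (exists X, twisted_eigen zeta lambda X) <->
  root (char_poly (twisted_mx zeta)) lambda.
Proof.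
rewrite -eigenvalue_root_char; split.
  move=> [X [[v Xv] XE]]; apply/eigenvalueP; exists (\row_j X (enum_val j)).
    apply/rowP => j; rewrite mul_row_twisted_mx !mxE.
    by rewrite -XE mulrBl opprB addrC subrK.
  apply/eqP => /rowP/(_ (enum_rank v)); rewrite !mxE enum_rankK.
  exact/eqP.
move=> /eigenvalueP [w wE w0]; exists (fun v => w 0 (enum_rank v)); split.
  have [i wi] : exists i, w 0 i != 0 by apply/rV0Pn.
  by exists (enum_val i); rewrite enum_valK.
move=> v; have /rowP/(_ (enum_rank v)) := wE.
rewrite mul_twisted_mx !mxE enum_rankK => /eqP.
by rewrite subr_eq addrC -subr_eq -mulrBl => /eqP ->.
Qed.

(** A [zeta] with values in [s] amounts to a position in [s] for each vertex, so only finitely many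
    matrices occur; [r] concatenates their spectra. *)
Lemma twisted_eigenvalues_finite (s : seq C) :
  exists r : seq C, forall zeta lambda X, (forall v, zeta v \in s) ->
    twisted_eigen zeta lambda X -> lambda \in r.
Proof.
pose M (f : {ffun V -> 'I_(size s)}) := twisted_mx (fun v => s`_(f v)).
exists (flatten [seq s2val (char_poly_seq_eigenvalues (M f)) |
                   f : {ffun V -> 'I_(size s)}]).
move=> zeta lambda X zs /(ex_intro _ X)/(iffLR (twisted_eigenP _ _)).
have idx v : (index (zeta v) s < size s)%N by rewrite index_mem zs.
have -> : twisted_mx zeta = M [ffun v => Ordinal (idx v)].
  by apply/matrixP => i j; rewrite !mxE ffunE nth_index.
set f := [ffun v => _]; rewrite (s2valP (char_poly_seq_eigenvalues (M f))).
rewrite root_prod_XsubC => zr; apply/flattenP.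
exists (s2val (char_poly_seq_eigenvalues (M f))) => //.
by apply: map_f; rewrite mem_enum.
Qed.

Lemma signless_hermsym : twisted_mx (fun=> -1) \is hermsymmx.
Proof.
apply: realsym_hermsym.
  apply/is_hermitianmxP; rewrite expr0 scale1r map_mx_id //.
  apply/matrixP => i j; rewrite !mxE e_sym (eq_sym j).
  by case: eqVneq => [->|].
apply/mxOverP => i j; rewrite !mxE mulNrn opprK.
by rewrite rpredD ?rpredMn ?realn ?real1.
Qed.

Lemma signless_form (x : V -> C) :
  let w := \row_(j < #|V|) x (enum_val j) in
  (forall v, x v \is Num.real) ->
  (w *m twisted_mx (fun=> -1) *m w ^t*) 0 0 =
    \sum_v (deg v)%:R * x v ^+ 2 + \sum_v \sum_(u | e v u) x v * x u.
Proof.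
move=> w xr; rewrite mxE -big_split /=.
rewrite [RHS](reindex _ (onW_bij _ (enum_val_bij V))) /=.
apply: eq_bigr => j _; rewrite mul_row_twisted_mx !mxE.
rewrite (CrealP (xr _)) mulN1r opprK mulrDl -mulrA -expr2 -mulr_sumr.
by rewrite [X in _ + X]mulrC.
Qed.

Lemma row_normsq (x : V -> C) :
  let w := \row_(j < #|V|) x (enum_val j) in
  (forall v, x v \is Num.real) -> (w *m w ^t*) 0 0 = \sum_v x v ^+ 2.
Proof.
move=> w xr; rewrite mxE [RHS](reindex _ (onW_bij _ (enum_val_bij V))) /=.
by apply: eq_bigr => j _; rewrite !mxE (CrealP (xr _)) expr2.
Qed.

(** Perron-type argument: where [y] vanishes, the nonnegative neighbour sum vanishes too, so
    positivity spreads along edges and, by connectedness, everywhere. *)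
Lemma nonneg_eigen_pos (q : C) (y : V -> C) :
  graph_connected e -> (forall v, 0 <= y v) ->
  twisted_eigen (fun=> -1) q y -> forall v, 0 < y v.
Proof.
move=> conn y0 [[v0 yv0] yE].
have step u v : e u v -> 0 < y u -> 0 < y v.
  move=> euv yu; rewrite lt0r y0 andbT; apply/eqP => yv.
  have /eqP := yE v; rewrite yv mulr0 mulN1r eq_sym oppr_eq0 psumr_eq0 //.
  move=> /allP/(_ u); rewrite mem_index_enum e_sym euv => /(_ isT)/=.
  by rewrite (gt_eqF yu).
move=> v; have /connectP[p] := conn v0 v.
have : 0 < y v0 by rewrite lt0r yv0 y0.
elim: p v0 {yv0} => [|u p IH] v0 yv0 /= => [_ -> //|/andP[/step/(_ yv0) yu pp]].
exact: IH.
Qed.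

Lemma signless_top_eigenvalue :
  (0 < #|V|)%N -> graph_connected e -> ~ bipartite e ->
  exists2 q : C, q \is Num.real &
    root (char_poly (twisted_mx (fun=> -1))) q /\
    forall zeta lambda X,
      (forall v, X v \is Num.real) -> (forall v, zeta v \in [:: 0; 1]) ->
      lambda \is Num.real -> twisted_eigen zeta lambda X -> lambda < q.
Proof.
move=> V0 conn nbip.
have [q qr [qeig qmax]] := hermsym_max_eigenvalue V0 signless_hermsym.
exists q => //; split; first by rewrite -eigenvalue_root_char.
move=> zeta lambda X Xr z01 lr [[v0 Xv0] XE].
rewrite real_ltNge //; apply/negP => ql; apply: nbip.
pose y v := `|X v|.
have yr v : y v \is Num.real by rewrite /y normr_real.
have y0 v : 0 <= y v by exact: normr_ge0.
have yX v : y v ^+ 2 = X v ^+ 2 by rewrite /y real_normK.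
have XyN v u : 0 <= X v * X u + y v * y u.
  rewrite /y -normrM addrC -[X in _ + X]opprK subr_ge0 -normrN.
  by rewrite real_ler_norm ?rpredN ?realM.
(* Each slack is nonnegative, and their sum is nonpositive if lambda >= q. *)
pose slack v := ((deg v)%:R - lambda) * y v ^+ 2 + \sum_(u | e v u) y v * y u.
(* Multiplying the eigenvalue equation at [v] by [X v] turns the first term into 0 or into the
   neighbour sum of [X v * X u], according to [zeta v]. *)
have slackE v : slack v =
    if zeta v == 0 then \sum_(u | e v u) y v * y u
    else \sum_(u | e v u) (X v * X u + y v * y u).
  rewrite /slack yX expr2 mulrA XE.
  have := z01 v; rewrite !inE => /orP[]/eqP ->.
    by rewrite eqxx !mul0r add0r.
  rewrite (negPf (oner_neq0 _)) mul1r mulr_suml -big_split.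
  by apply: eq_bigr => u _; rewrite (mulrC (X u)).
have slack0 v : 0 <= slack v.
  by rewrite slackE; case: ifP => _; apply: sumr_ge0 => u _; rewrite ?mulr_ge0.
have [] := qmax (\row_j y (enum_val j)).
rewrite signless_form // row_normsq //.
set F := (X in X <= _); set N := \sum_v y v ^+ 2 => Fq Feq.
have N0 : 0 <= N by apply: sumr_ge0 => v _; rewrite exprn_ge0.
have slackF : \sum_v slack v = F - lambda * N.
  rewrite /slack big_split /= /F addrAC; congr (_ + _).
  by rewrite mulr_sumr -sumrB; apply: eq_bigr => v _; rewrite mulrBl.
have qN : q * N <= lambda * N by rewrite ler_wpM2r.
have s0 : \sum_v slack v = 0.
  apply/eqP; rewrite eq_le sumr_ge0 // andbT slackF subr_le0.
  exact: le_trans Fq qN.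
have slackv v : slack v = 0.
  have /eqP := s0; rewrite psumr_eq0 // => /allP/(_ v).
  by rewrite mem_index_enum => /(_ isT)/eqP.
have FE : F = q * N.
  apply/eqP; rewrite eq_le Fq /= (le_trans qN) //.
  by rewrite -subr_ge0 -slackF s0.
(* The Rayleigh bound for D + A is attained at [y], so [y] is an eigenvector for [q], hence
   positive. *)
have ypos : forall v, 0 < y v.
  apply: (@nonneg_eigen_pos q) => //; split.
    by exists v0; rewrite normr_eq0.
  move=> v; have /rowP/(_ (enum_rank v)) := Feq FE.
  rewrite mul_row_twisted_mx !mxE enum_rankK => /eqP.
  by rewrite subr_eq addrC -subr_eq -mulrBl => /eqP ->.
(* A vanishing sum of nonnegative terms kills each term. For [zeta v = 0] this contradicts
   [0 < y v * y u]; otherwise [X v * X u] is the opposite of [y v * y u]. *)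
have XN v u : e v u -> X v * X u < 0.
  move=> evu; have /eqP := slackv v.
  have yy : 0 < y v * y u by rewrite mulr_gt0.
  have yy0 w : 0 <= y v * y w by rewrite mulr_ge0.
  rewrite slackE; case: ifP => _; rewrite psumr_eq0 // => /allP/(_ u).
    by rewrite mem_index_enum evu (gt_eqF yy) => /(_ isT).
  rewrite mem_index_enum evu => /(_ isT)/=.
  by rewrite addr_eq0 => /eqP ->; rewrite oppr_lt0.
exists [set v | 0 < X v] => u v euv; rewrite !inE.
have Xuv := XN _ _ euv.
have Xu0 : X u != 0 by apply: contraTneq Xuv => ->; rewrite mul0r ltxx.
case: (boolP (0 < X u)) => [Xu|].
  by move: Xuv; rewrite pmulr_rlt0 // => /lt_gtF ->.
rewrite -real_leNgt // le_eqVlt (negPf Xu0) /= => Xu.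
by move: Xuv; rewrite nmulr_rlt0 // => ->.
Qed.

End TwistedGraph.

(** * The Laplacian tensor of a uniform hypergraph *)

Section Tensor.
Variables (R : realType) (W : finType).

Lemma tensor_apply_cons k (T : tensor R W k.+1) (x : {ffun W -> R[i]}) w :
  tensor_apply T x w =
    \sum_(s : k.-tuple W) (T (cons_tuple w s))%:C * \prod_(j <- s) x j.
Proof.
rewrite /tensor_apply (reindex_onto (cons_tuple w) (@behead_tuple _ _)) /=.
  by apply: eq_big => [s|s _]; rewrite ?eqxx //=; apply/eqP/val_inj.
by move=> t; case/tupleP: t => v s /eqP[->]; apply: val_inj.
Qed.

(** The tuple [w :: s] has exactly as many entries as [A] has elements, so it covers [A] only by
    listing it without repetition. *)
Lemma big_uniq_cover (A : {set W}) w (k : nat) (s : k.-tuple W) :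
  w \in A -> #|A| = k.+1 ->
  ([set v in cons_tuple w s] == A) = all [in A :\ w] s && uniq s.
Proof.
move=> wA Ak.
have szA : #|A :\ w| = k by move: Ak; rewrite (cardsD1 w) wA => -[].
apply/eqP/andP => [sA|[/allP sA su]].
  have ws_uniq : uniq (w :: s).
    apply/card_uniqP; rewrite /= size_tuple -Ak -sA cardsE.
    by apply: eq_card => v; rewrite !inE.
  have /andP[ws su] := ws_uniq; split=> //; apply/allP => v vs.
  rewrite inE -sA !inE vs orbT andbT.
  by apply: contraNneq ws => <-.
have sE : [set v in s] = A :\ w.
  apply/eqP; rewrite eqEcard szA cardsE (card_uniqP su) size_tuple leqnn andbT.
  by apply/subsetP => v; rewrite inE => /sA.
by apply/setP => v; rewrite -(setD1K wA) -sE !inE.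
Qed.

Lemma prod_uniq_cover (F : W -> R[i]) (A : {set W}) k (s : k.-tuple W) :
  #|A| = k -> all [in A] s -> uniq s ->
  \prod_(j <- s) F j = \prod_(j in A) F j.
Proof.
move=> Ak /allP sA su; rewrite [LHS]big_uniq //=; apply: eq_bigl => v.
suff -> : A = [set v in s] by rewrite inE.
apply/esym/eqP; rewrite eqEcard Ak cardsE (card_uniqP su) size_tuple leqnn.
rewrite andbT.
by apply/subsetP => u; rewrite inE => /sA.
Qed.

(** Each edge through [w] is covered by (k-1)! tuples starting at [w], one per ordering of its other
    vertices, which cancels the factor 1/(k-1)!. *)
Lemma laplacian_apply k (E : {set {set W}}) (x : {ffun W -> R[i]}) w :
  (0 < k)%N -> (forall A, A \in E -> #|A| = k) ->
  tensor_apply (laplacian_tensor R k E) x w =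
    (hdegree E w)%:R * x w ^+ k.-1
    - \sum_(A in E | w \in A) \prod_(j in A :\ w) x j.
Proof.
case: k => // k _ Ek; rewrite tensor_apply_cons.
under eq_bigr => s _ do rewrite ffunE rmorphB mulrBl.
rewrite sumrB; congr (_ - _).
  rewrite (bigD1 (nseq_tuple k w)) //= [X in _ + X]big1 => [|s sw].
    rewrite addr0 ffunE /= all_nseq /= eqxx orbT rmorph_nat; congr (_ * _).
    by rewrite big_nseq -[RHS]iter_mulr_1.
  rewrite ffunE /=; case: ifP; rewrite ?mul0r // => /all_pred1P sE.
  by case/eqP: sw; apply: val_inj; rewrite /= {}sE size_tuple.
rewrite (bigID (fun s : k.-tuple W => [set v in cons_tuple w s] \in E)) /=.
rewrite [X in _ + X]big1 ?addr0 => [|s /negPf sE]; last first.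
  by rewrite ffunE sE mul0r.
rewrite (partition_big (fun s : k.-tuple W => [set v in cons_tuple w s])
           (fun A => (A \in E) && (w \in A))) /=; last first.
  by move=> s ->; rewrite !inE eqxx.
apply: eq_bigr => A /andP[AE wA].
have szA : #|A :\ w| = k by have := Ek A AE; rewrite (cardsD1 w) wA => -[].
transitivity (\sum_(s in [set s : k.-tuple W | all [in A :\ w] s & uniq s])
   (k`!%:R)^-1%:C * \prod_(j in A :\ w) x j).
  apply: eq_big => [s|s].
    by rewrite inE -(big_uniq_cover _ wA (Ek _ AE)); apply/andb_idl => /eqP ->.
  case/andP=> sE /eqP sA; rewrite ffunE sE /=; congr (_ * _).
  have := big_uniq_cover s wA (Ek _ AE); rewrite sA eqxx => /esym/andP[h1 h2].
  exact: prod_uniq_cover.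
rewrite sumr_const card_uniq_tuples szA ffactnn -[LHS]mulr_natl mulrA.
rewrite fmorphV rmorph_nat divff ?mul1r //.
by rewrite pnatr_eq0 -lt0n fact_gt0.
Qed.

End Tensor.

(** * Generalized powers *)

Section Power.
Variables (R : realType) (V : finType) (e : rel V) (k : nat).
Hypotheses (e_sym : symmetric e) (e_irr : irreflexive e).
Hypotheses (k_even : ~~ odd k) (k_large : (1 < k./2)%N).
Local Notation W := (power_vertex V k).
Local Notation L := (laplacian_tensor R k (power_edges e k)).
Local Notation C := R[i].
Implicit Types (x : {ffun W -> C}) (v u : V) (j : 'I_(k./2)).

Let k_gt0 : (0 < k)%N.
Proof. by case: k k_large. Qed.

Let kE : k = (k./2 + k./2)%N.
Proof. by rewrite addnn even_halfK. Qed.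

Definition block_prod x v : C := \prod_j x (v, j).

Lemma prod_block x v : \prod_(p in block k v) x p = block_prod x v.
Proof.
rewrite (reindex_onto (fun j => (v, j)) snd) /=; last first.
  by move=> [u j]; rewrite inE /= => /eqP->.
by apply: eq_bigl => j; rewrite inE !eqxx.
Qed.

Lemma card_block v : #|block k v| = k./2.
Proof.
rewrite -sum1_card (reindex_onto (fun j => (v, j)) snd) /=; last first.
  by move=> [u j]; rewrite inE /= => /eqP->.
rewrite -[RHS]card_ord -sum1_card.
by apply: eq_bigl => j; rewrite !inE !eqxx.
Qed.

Lemma disjoint_block v u : v != u -> [disjoint block k v & block k u].
Proof.
move=> vu; rewrite disjoint_subset; apply/subsetP => p; rewrite !inE => /eqP->.
exact: vu.
Qed.

Let edge_neq v u : e v u -> v != u.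
Proof. by apply: contraTneq => ->; rewrite e_irr. Qed.

Lemma card_power_edge (A : {set W}) : A \in power_edges e k -> #|A| = k.
Proof.
case/imsetP => -[v u]; rewrite inE /= => evu ->.
rewrite cardsU !card_block disjoint_setI0 ?disjoint_block ?edge_neq //.
by rewrite cards0 subn0 -kE.
Qed.

Lemma power_edges_at v j :
  [set A in power_edges e k | (v, j) \in A] =
    [set block k v :|: block k u | u in [set u | e v u]].
Proof.
apply/setP => A; rewrite inE; apply/andP/imsetP.
  case=> /imsetP[[a b]]; rewrite inE /= => eab ->; rewrite !inE /=.
  case/orP=> /eqP ->; first by exists b; rewrite ?inE.
  by exists a; [rewrite inE e_sym|rewrite setUC].
case=> u; rewrite inE => evu ->; split; last by rewrite !inE eqxx.
by apply/imsetP; exists (v, u); rewrite ?inE.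
Qed.

Lemma edge_at_inj v (j : 'I_(k./2)) :
  {in [set u | e v u] &, injective (fun u => block k v :|: block k u)}.
Proof.
move=> u u'; rewrite !inE => evu _ /setP/(_ (u, j)); rewrite !inE /= eqxx orbT.
by rewrite eq_sym (negPf (edge_neq evu)) => /esym/eqP.
Qed.

Lemma hdegree_power v j : hdegree (power_edges e k) (v, j) = deg e v.
Proof. by rewrite /hdegree power_edges_at (card_in_imset (edge_at_inj j)). Qed.

Lemma power_apply x v j :
  tensor_apply L x (v, j) =
    (deg e v)%:R * x (v, j) ^+ k.-1 -
    \sum_(u | e v u) \prod_(p in (block k v :|: block k u) :\ (v, j)) x p.
Proof.
rewrite laplacian_apply ?hdegree_power //; last exact: card_power_edge.
congr (_ - _).
transitivity (\sum_(A in [set A in power_edges e k | (v, j) \in A])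
   \prod_(p in A :\ (v, j)) x p).
  by apply: eq_bigl => A; rewrite inE.
rewrite power_edges_at big_imset; last exact: edge_at_inj.
by apply: eq_bigl => u; rewrite inE.
Qed.

(** The factor [x (v, j)] restores the vertex deleted from each edge; the product over the edge is
    then X_v X_u, which does not depend on [j]. *)
Lemma power_apply_mul x v j :
  tensor_apply L x (v, j) * x (v, j) =
    (deg e v)%:R * x (v, j) ^+ k -
    block_prod x v * \sum_(u | e v u) block_prod x u.
Proof.
rewrite power_apply mulrBl -mulrA -exprSr prednK //; congr (_ - _).
rewrite mulr_suml mulr_sumr; apply: eq_bigr => u evu.
rewrite -!prod_block mulrC.
rewrite -big_setD1 ?inE ?eqxx // -bigU ?disjoint_block ?edge_neq //.
by apply: eq_bigl => p; rewrite !inE.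
Qed.

Lemma eigenpair_block_prod x lambda v j :
  eigenpair L lambda x ->
  ((deg e v)%:R - lambda) * x (v, j) ^+ k =
    block_prod x v * \sum_(u | e v u) block_prod x u.
Proof.
move=> [_ /(_ (v, j))/(congr1 (fun z => z * x (v, j)))].
rewrite power_apply_mul -mulrA -exprSr prednK // => /eqP.
by rewrite subr_eq addrC -subr_eq -mulrBl => /eqP.
Qed.

(** At a nonzero entry the factor [x (v, j)] cancels. At a zero entry the whole block vanishes, so
    every product keeps a zero factor. *)
Lemma block_prod_eigenpair x lambda :
  x != 0 -> (forall v j, block_prod x v = 0 -> x (v, j) = 0) ->
  (forall v j, ((deg e v)%:R - lambda) * x (v, j) ^+ k =
    block_prod x v * \sum_(u | e v u) block_prod x u) ->
  eigenpair L lambda x.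
Proof.
move=> x0 X0 xE; split=> // -[v j].
have [xvj|xvj] := eqVneq (x (v, j)) 0; last first.
  apply: (mulIf xvj); rewrite power_apply_mul -(xE v j) -mulrA.
  rewrite -exprSr prednK //.
  by rewrite mulrBl opprB addrC subrK.
have k1 : k.-1 != 0%N by case: k k_large => [|[]].
have Xv : block_prod x v = 0 by rewrite /block_prod (bigD1 j) //= xvj mul0r.
rewrite power_apply xvj expr0n (negPf k1) !mulr0 sub0r big1 ?oppr0 // => u _.
(* Blocks have at least two vertices, so one remains besides (v, j). *)
have [j' j'j] : exists j', j' != j.
  by apply/card_gt0P; rewrite cardC1 card_ord -ltnS prednK // ltnW.
rewrite (bigD1 (v, j')) /=; last by rewrite !inE eqxx andbT xpair_eqE eqxx.
by rewrite (X0 _ j' Xv) mul0r.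
Qed.

Let j0 : 'I_(k./2) := Ordinal (ltnW k_large).

(* If lambda is the degree of v, the indicator of v and zeta = 0 do the job. *)
Lemma eigenpair_twisted x lambda :
  eigenpair L lambda x ->
  exists zeta X : V -> C,
    [/\ forall v, zeta v ^+ (k./2).+1 = zeta v,
        twisted_eigen e zeta lambda X &
        (forall p, x p \is Num.real) ->
        forall v, X v \is Num.real /\ zeta v \is Num.real].
Proof.
move=> xe.
have [/existsP[v /eqP lE]|] := boolP [exists v, (deg e v)%:R == lambda].
  exists (fun=> 0), (fun u => (u == v)%:R); split=> [u||_ u].
  - by rewrite expr0n.
  - split; first by exists v; rewrite eqxx oner_eq0.
    move=> u; rewrite mul0r; case: eqVneq => [->|_]; last by rewrite mulr0.
    by rewrite lE subrr mul0r.
  - by rewrite realn real0.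
rewrite negb_exists => /forallP lN.
have {}lN v : (deg e v)%:R - lambda != 0 by rewrite subr_eq0.
have xE v j := eigenpair_block_prod v j xe.
set X := block_prod x in xE *.
have xX v j : x (v, j) != 0 -> X v != 0.
  move=> xvj; have : X v * \sum_(u | e v u) X u != 0.
    by rewrite -(xE v j) mulf_neq0 ?expf_neq0.
  by rewrite mulf_eq0 negb_or => /andP[].
(* The inverse of 0 is 0 here, so [zeta v = 0] where [x (v, j0) = 0]. *)
exists (fun v => X v ^+ 2 / x (v, j0) ^+ k), X; split=> [v||xr v].
- have [x0|x0] := eqVneq (x (v, j0)) 0.
    by rewrite x0 expr0n -[k]prednK //= invr0 mulr0 expr0n.
  rewrite exprSr expr_div_n -exprM mul2n even_halfK //.
  (* All k-th powers of entries in a block agree, since the nonzero difference of degree and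
     [lambda] cancels. *)
  have -> : X v ^+ k = (x (v, j0) ^+ k) ^+ k./2.
    rewrite /X /block_prod -prodrXl -[X in _ ^+ X]card_ord -prodr_const.
    by apply: eq_bigr => j _; apply: (mulfI (lN v)); rewrite !xE.
  by rewrite divff ?mul1r // !expf_neq0.
- split.
    have [[v j] xvj] : exists p, x p != 0.
      apply/existsP; rewrite -negb_forall; apply: contra xe.1 => /forallP x0.
      by apply/eqP/ffunP => p; rewrite ffunE; apply/eqP.
    by exists v; apply: xX xvj.
  move=> v; have [x0|x0] := eqVneq (x (v, j0)) 0.
    have Xv : X v = 0 by rewrite /X /block_prod (bigD1 j0) //= x0 mul0r.
    by rewrite Xv expr0n /= !mul0r mulr0.
  apply: (mulIf (expf_neq0 k x0)); rewrite mulrAC xE.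
  by rewrite [RHS]mulrAC divfK ?expf_neq0 // expr2 mulrAC.
- have Xr : X v \is Num.real by apply: rpred_prod.
  by split=> //; rewrite rpredM ?rpredX ?rpredV ?rpredX.
Qed.

(* In each block, eta times an m-th root of X_v / eta in one place and this root
   elsewhere have product X_v and the same k-th power X_v^2 / eta^2. *)
Lemma twisted_eigenvalue (eta lambda : C) (X : V -> C) :
  eta ^+ k = 1 -> twisted_eigen e (fun=> eta ^+ 2) lambda X ->
  Defs.eigenvalue L lambda.
Proof.
move=> eta1 [[v0 Xv0] XE]; have m_gt0 : (0 < k./2)%N by apply: ltnW.
have eta0 : eta != 0.
  apply: contra_eq_neq eta1 => ->.
  by rewrite expr0n gtn_eqF // eq_sym oner_neq0.
pose a v := k./2.-root (X v / eta).
have aE v : a v ^+ k./2 = X v / eta by rewrite rootCK.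
pose x : {ffun W -> C} := [ffun p => if p.2 == j0 then eta * a p.1 else a p.1].
have xX v : block_prod x v = X v.
  rewrite /block_prod (bigD1 j0) //= ffunE eqxx /=.
  rewrite (eq_bigr (fun=> a v)) => [|j /negPf jj0]; last first.
    by rewrite ffunE /= jj0.
  rewrite prodr_const cardC1 card_ord -mulrA -exprS prednK // aE.
  by rewrite mulrC divfK.
have x0 v j : X v = 0 -> x (v, j) = 0.
  move=> Xv; have /eqP := aE v; rewrite Xv mul0r expf_eq0 m_gt0 /= => /eqP av.
  by rewrite ffunE /= av mulr0 if_same.
exists x; apply: block_prod_eigenpair => [|v j|v j].
- apply: contraNneq Xv0 => x00; rewrite -xX /block_prod (bigD1 j0) //= x00.
  by rewrite ffunE mul0r.
- by rewrite xX; apply: x0.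
rewrite xX (eq_bigr X) => [|u _]; last exact: xX.
have -> : x (v, j) ^+ k = (X v / eta) ^+ 2.
  rewrite -aE -exprM muln2 even_halfK // ffunE /=.
  by case: ifP => // _; rewrite exprMn eta1 mul1r.
rewrite expr_div_n [X v ^+ 2]expr2 -[X v * X v / _]mulrA [LHS]mulrA XE.
by rewrite mulrC mulrA divfK ?expf_neq0.
Qed.

(** The all-ones vector works because its neighbour sum equals the degree. This supplies a candidate
    for the largest H-eigenvalue. *)
Lemma H_eigenvalue0 (v0 : V) : H_eigenvalue L 0.
Proof.
exists [ffun=> 1]; apply: block_prod_eigenpair => [|v j|v j].
- by apply/eqP => /ffunP/(_ (v0, j0)) /eqP; rewrite !ffunE oner_eq0.
- by move/eqP; rewrite /block_prod big1 ?oner_eq0 // => i _; rewrite !ffunE.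
have X1 u : block_prod [ffun i : W => ([ffun=> 1 : R] i)%:C] u = 1.
  by rewrite /block_prod big1 // => i _; rewrite !ffunE.
rewrite subr0 !ffunE expr1n mulr1 X1 mul1r (eq_bigr (fun=> 1)) => [|u _ //].
by rewrite sumr_const /deg cardsE.
Qed.

End Power.

(** * Roots of unity near -1 and existence of the maxima *)

Lemma de_moivre (R : realType) (t : R) n :
  (cos t +i* sin t) ^+ n = cos (t *+ n) +i* sin (t *+ n).
Proof.
elim: n => [|n IH]; first by rewrite expr0 mulr0n cos0 sin0.
rewrite exprS IH mulrS cosD sinD; apply/eqP; rewrite eq_complex /= eqxx /=.
by rewrite addrC.
Qed.

(** The witness is z = exp(i pi/m), with |z - 1|^2 = 2 (1 - cos(pi/m)), and [cos] is continuous at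
    0. *)
Lemma ex_rootN1_near1 (R : realType) (eps : R) : 0 < eps ->
  exists K, forall m, (K <= m)%N -> (0 < m)%N ->
    exists2 z : R[i], z ^+ m = -1 & `|z - 1| < eps%:C.
Proof.
move=> e0; have e2 : 0 < eps ^+ 2 / 2 by rewrite divr_gt0 // exprn_gt0.
have /cvgrPdist_lt dcos := @continuous_cos R 0.
move: (dcos _ e2).
rewrite cos0 => {dcos} /nbhs_ballP[d /= d0 dcos].
exists (Num.Def.archi_bound (pi / d)) => m Km m0.
have mR : 0 < m%:R :> R by rewrite ltr0n.
exists (cos (pi / m%:R) +i* sin (pi / m%:R)).
  rewrite de_moivre -[pi / _ *+ m]mulr_natr divfK ?gt_eqF // cospi sinpi.
  by apply/eqP; rewrite eq_complex /= oppr0 !eqxx.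
have : ball 0 d (pi / m%:R : R).
  rewrite /ball /= sub0r normrN gtr0_norm ?divr_gt0 ?pi_gt0 //.
  rewrite ltr_pdivrMr // mulrC -ltr_pdivrMr //.
  apply: lt_le_trans (archi_boundP _) _; first by rewrite divr_ge0 ?pi_ge0 ?ltW.
  by rewrite ler_nat.
move=> /dcos /=; move: (pi / m%:R) => t tcos.
rewrite -(@ltr_pXn2r _ 2) ?nnegrE ?normr_ge0 ?ler0c ?(ltW e0) //.
rewrite -add_Re2_Im2 -rmorphXn ltcR /=.
rewrite subr0 -[X in _ < X](divfK (_ : 2 != 0)) ?pnatr_eq0 //.
have -> : (cos t - 1) ^+ 2 + sin t ^+ 2 = (1 - cos t) * 2.
  have -> : sin t ^+ 2 = 1 - cos t ^+ 2 by rewrite -(cos2Dsin2 t) addrC addKr.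
  by ring.
by rewrite ltr_pM2r // (le_lt_trans _ tcos) // ler_norm.
Qed.

(** A nonzero such [z] is an m-th root of unity, hence 1 or -1 when real, and odd [m] excludes
    -1. *)
Lemma real_root_of_unity (C : numClosedFieldType) (z : C) m :
  z \is Num.real -> odd m -> z ^+ m.+1 = z -> z \in [:: 0; 1].
Proof.
move=> zr om zE; rewrite !inE; have [//|z0 /=] := eqVneq z 0.
have m0 : (0 < m)%N by case: m om {zE}.
have z1 : z ^+ m = 1 by apply: (mulfI z0); rewrite -exprS zE mulr1.
have : `|z| = 1.
  by apply/eqP; rewrite -(pexpr_eq1 m0) // -normrX z1 normr1.
case/orP: zr => z_sgn; first by rewrite ger0_norm // => ->.
rewrite ler0_norm // => /eqP; rewrite eqr_oppLR => /eqP zN1.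
move: z1; rewrite zN1 -signr_odd om expr1 => /eqP.
by rewrite eq_sym -subr_eq0 opprK (pnatr_eq0 _ 2).
Qed.

Lemma ex_max_finite (R : realDomainType) (r : seq R) (P : R -> Prop) :
  (forall x, P x -> x \in r) -> (exists x, P x) ->
  exists2 x, P x & forall y, P y -> y <= x.
Proof.
elim: r P => [|a r IH] P Pr [x Px]; first by have := Pr x Px.
have [[y [Py ya]]|noy] := pselect (exists y, P y /\ y != a); last first.
  have xa : x = a by apply/eqP/negPn/negP => xa; apply: noy; exists x.
  exists x => // y Py; case: (eqVneq y a) => [->|ya]; first by rewrite xa.
  by case: noy; exists y.
have [||z [Pz za] zmax] := IH (fun y => P y /\ y != a).
  by move=> w [/Pr]; rewrite inE => /orP[->|].
  by exists y.
have [Pa|Pa] := pselect (P a); last first.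
  exists z => // w Pw; apply: zmax; split=> //; apply/eqP => wa.
  by apply: Pa; rewrite -wa.
have [le_az|lt_za] := leP a z.
  by exists z => // w Pw; case: (eqVneq w a) => [->|wa] //; apply: zmax.
exists a => // w Pw; case: (eqVneq w a) => [->|wa] //.
by apply: le_trans (ltW lt_za); apply: zmax.
Qed.

(** Turns strict inequalities against [q] over a finite set into one uniform bound, which later
    serves all [k] at once. *)
Lemma ex_below_gap (R : realDomainType) (r : seq R) q :
  exists2 b, b < q & forall z, z \in r -> z < q -> z <= b.
Proof.
elim: r => [|a r [b bq rb]]; first by exists (q - 1); rewrite ?gtrBl.
have [aq|qa] := ltP a q.
  exists (Num.max a b) => [|z]; first by rewrite gt_max aq.
  rewrite inE le_max => /predU1P[->|zr zq]; first by rewrite lexx.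
  by rewrite (rb z) ?orbT.
exists b => // z; rewrite inE => /predU1P[->|]; last exact: rb.
by rewrite ltNge qa.
Qed.

(** The moduli of the eigenvalues form a finite set; [complex.Re] transports them to [R], where the
    order is total. *)
Lemma spectral_radius_exists (R : realType) (I : finType) k (T : tensor R I k)
    (r : seq R[i]) :
  (forall z, Defs.eigenvalue T z -> z \in r) ->
  (exists z, Defs.eigenvalue T z) -> exists rho, spectral_radius T rho.
Proof.
move=> Tr [z0 Tz0].
pose P (x : R) := exists2 z, Defs.eigenvalue T z & `|z| = x%:C.
have normE (z : R[i]) : `|z| = (complex.Re `|z|)%:C.
  by rewrite RRe_real ?normr_real.
have [x||rho rhoP rho_max] := @ex_max_finite _ [seq complex.Re `|z| | z <- r] P.
- move=> [z /Tr zr zx]; apply/mapP; exists z => //.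
  by apply: complexI; rewrite -normE zx.
- by exists (complex.Re `|z0|), z0.
exists rho; split=> // z Tz; rewrite normE lecR; apply: rho_max.
by exists z.
Qed.

Lemma H_eigenvalue_real (R : realType) (I : finType) k (T : tensor R I k)
    (z : R[i]) : H_eigenvalue T z -> z \is Num.real.
Proof.
move=> [y [y0 yE]].
have [i yi] : exists i, y i != 0.
  apply/existsP; rewrite -negb_forall; apply: contra y0 => /forallP y0.
  by apply/eqP/ffunP => i; rewrite !ffunE (eqP (y0 i)).
have yiC : (y i)%:C ^+ k.-1 != 0 by rewrite expf_neq0 // fmorph_eq0.
have rC (a : R) : a%:C \is Num.real by apply/complex_realP; exists a.
have := yE i; rewrite ffunE => /(canLR (mulfK yiC)) <-.
rewrite rpredM ?rpredV ?rpredX //; apply: rpred_sum => t _.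
by rewrite rpredM //; apply: rpred_prod => j _; rewrite ffunE.
Qed.

Lemma largest_H_eigenvalue_exists (R : realType) (I : finType) k
    (T : tensor R I k) (r : seq R[i]) :
  (forall z, H_eigenvalue T z -> z \in r) ->
  (exists z, H_eigenvalue T z) -> exists l, largest_H_eigenvalue T l.
Proof.
move=> Tr [z0 Tz0].
have HR z : H_eigenvalue T z -> (complex.Re z)%:C = z.
  by move/H_eigenvalue_real/RRe_real.
pose P (x : R) := H_eigenvalue T x%:C.
have [x||l lP l_max] := @ex_max_finite _ [seq complex.Re z | z <- r] P.
- by move=> /Tr xr; apply/mapP; exists x%:C.
- by exists (complex.Re z0); rewrite /P HR.
exists l; split=> // z Tz; rewrite -(HR z) // lecR; apply: l_max.
by rewrite /P HR.
Qed.

(** * Separation of the two maxima *)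

Lemma twisted_mx_norm_gt (C : numClosedFieldType) (V : finType) (e : rel V)
    (q b : C) :
  b \is Num.real -> q \is Num.real -> b < q ->
  root (char_poly (twisted_mx e (fun=> -1))) q ->
  exists2 d : C, 0 < d & forall z, `|z| = 1 -> `|z + 1| < d ->
    exists2 x, root (char_poly (twisted_mx e (fun=> z))) x & b < `|x|.
Proof.
move=> br qr bq q_root.
(* [A] is q - D and [B] the transposed adjacency matrix, so the characteristic matrix at [q] is
   affine in [z]; its determinant vanishes at [z = -1]. *)
pose A := q%:M - twisted_mx e (fun=> 0 : C).
pose B : 'M[C]_#|V| := \matrix_(i, j) (e (enum_val j) (enum_val i))%:R.
have cE z : (char_poly (twisted_mx e (fun=> z))).[q] = \det (A + z *: B).
  rewrite horner_char_poly; congr (\det _); apply/matrixP => i j; rewrite !mxE.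
  by rewrite mul0rn subr0 opprB mulr_natr addrA addrAC.
have [||d d0 dP] := @det_pencil_small _ _ A B (-1) ((q - b) ^+ #|V|).
- by rewrite -cE; apply/eqP.
- by rewrite exprn_gt0 // subr_gt0.
exists d => // z z1 zd; apply: (@ex_eigenvalue_norm_gt _ _ _ q) => //.
by rewrite cE; apply: dP; rewrite ?z1 ?opprK.
Qed.

Theorem theorem3p4 (R : realType) (V : finType) (e : rel V)
    (e_sym : symmetric e) (e_irr : irreflexive e)
    (e_conn : graph_connected e) (e_nbip : ~ bipartite e) :
  exists K : nat, forall k : nat, (K <= k)%N -> k = 2 %[mod 4] ->
    exists lambda_max rho : R,
      [/\ largest_H_eigenvalue (laplacian_tensor R k (power_edges e k))
            lambda_max,
          spectral_radius (laplacian_tensor R k (power_edges e k)) rho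
        & lambda_max < rho].
Proof.
have V_gt0 : (0 < #|V|)%N.
  rewrite lt0n; apply/negP => /eqP/card0_eq V0; apply: e_nbip.
  by exists finset.set0 => u; have := V0 u.
have [v0 _] := card_gt0P V_gt0.
have [qC /complex_realP[q ->] [q_root q_top]] :=
  @signless_top_eigenvalue R[i] V e e_sym V_gt0 e_conn e_nbip.
(* [r] and the gap bound [b] come from zeta in {0, 1} alone, so they do not depend on [k] and [K]
   can be chosen after them. *)
have [r rP] := twisted_eigenvalues_finite e ([:: 0; 1] : seq R[i]).
have [b bq rb] := ex_below_gap [seq complex.Re z | z <- r] q.
have bR : b%:C \is Num.real by apply/complex_realP; exists b.
have qR : q%:C \is Num.real by apply/complex_realP; exists q.
have [|dC dC0 dP] := twisted_mx_norm_gt bR qR _ q_root; first by rewrite ltcR.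
have [d dE] := complex_realP _ (gtr0_real dC0).
have d0 : 0 < d by rewrite -ltcR -dE.
have [K0 K0P] := ex_rootN1_near1 d0.
(* Doubling gives k/2 at least [K0], and adding 4 gives blocks of at least two vertices. *)
exists (K0.*2 + 4)%N => k Kk k2.
have k_even : ~~ odd k by lia.
have m_odd : odd k./2 by lia.
have k_large : (1 < k./2)%N by lia.
have Km : (K0 <= k./2)%N by lia.
set T := laplacian_tensor _ _ _.
have [mu muT mu_gt] : exists2 mu, Defs.eigenvalue T mu & b%:C < `|mu|.
  (* [xi] is an m-th root of -1 near 1, so for odd m the number [- xi] is an m-th root of unity near
     -1. *)
  have [xi xiE xi1] := K0P _ Km (ltnW k_large).
  have xi_norm : `|- xi| = 1.
    rewrite normrN; apply/eqP; rewrite -(pexpr_eq1 (ltnW k_large)) //.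
    by rewrite -normrX xiE normrN1.
  have [|mu mu_root mu_gt] := dP _ xi_norm; first by rewrite addrC distrC dE.
  have [X XE] := iffRL (twisted_eigenP _ _ _) mu_root.
  exists mu => //.
  (* The square root eta of [- xi] satisfies eta^k = (- xi)^m = 1. *)
  apply: (@twisted_eigenvalue _ _ _ _ _ _ _ _ (sqrtC (- xi)) _ X) => //.
    rewrite -(even_halfK k_even) -mul2n exprM sqrtCK exprNn xiE.
    by rewrite -signr_odd m_odd mulrNN mulr1.
  by rewrite sqrtCK.
(* For this [k] every possible value of zeta is a root of X^(m+1) - X, so all eigenvalues lie in a
   finite list. *)
have [s sE] := closed_field_poly_normal ('X^((k./2).+1) - 'X : {poly R[i]}).
have s0 : 'X^((k./2).+1) - 'X != 0 :> {poly R[i]}.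
  apply/eqP => /polyP/(_ 1%N); rewrite coefB coefXn coefX coef0 eqxx.
  rewrite (ltn_eqF (ltnW k_large : (1 < (k./2).+1)%N)) /= sub0r => /eqP.
  by rewrite oppr_eq0 oner_eq0.
have sP z : z ^+ (k./2).+1 = z -> z \in s.
  have lead0 : lead_coef ('X^((k./2).+1) - 'X : {poly R[i]}) != 0.
    by rewrite lead_coef_eq0.
  move=> zE; rewrite -root_prod_XsubC -(rootZ _ _ lead0).
  by rewrite -sE /root !hornerE zE subrr.
have [r' r'P] := twisted_eigenvalues_finite e s.
have eig_r' z : Defs.eigenvalue T z -> z \in r'.
  case=> x /(eigenpair_twisted e_sym e_irr k_even k_large).
  case=> zeta [X [zetaE XE _]].
  by apply: (r'P zeta _ X) => // v; apply/sP/zetaE.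
have H_eig z : H_eigenvalue T z -> Defs.eigenvalue T z.
  by case=> y yT; eexists; apply: yT.
(* For a real eigenvector zeta lies in {0, 1}, so [z] is in [r] and below [q], hence at most [b]. *)
have H_le z : H_eigenvalue T z -> z <= b%:C.
  move=> zH; have zR := H_eigenvalue_real zH; case: zH => y.
  case/(eigenpair_twisted e_sym e_irr k_even k_large).
  move=> zeta [X [zetaE XE real]].
  have {real} XR v : X v \is Num.real /\ zeta v \is Num.real.
    by apply: real => p; rewrite ffunE; apply/complex_realP; exists (y p).
  have z01 v : zeta v \in [:: 0; 1].
    by apply: (real_root_of_unity (XR v).2 m_odd).
  have zr := rP _ _ _ z01 XE.
  have zq := q_top _ _ _ (fun v => (XR v).1) z01 zR XE.
  rewrite -(RRe_real zR) lecR; apply: rb; first exact: map_f.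
  by rewrite -ltcR RRe_real.
have [||l lP] := @largest_H_eigenvalue_exists _ _ _ T r'.
- by move=> z /H_eig/eig_r'.
- by exists 0; apply: H_eigenvalue0.
have [|rho rhoP] := @spectral_radius_exists _ _ _ T r' eig_r'.
  by exists mu.
exists l, rho; split=> //; rewrite -ltcR.
apply: le_lt_trans (H_le _ lP.1) _.
exact: lt_le_trans mu_gt (rhoP.2 _ muT).
Qed.
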